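(* Let $d\ge1$. For every $\Lambda>0$ the function $K_{\mathfrak{m}_\Lambda}:\mathbb{T}^d\to\mathbb{C}$, $K_{\mathfrak{m}_\Lambda}(x)=\sum_{n\in\mathbb{Z}^d}\mathfrak{m}_\Lambda(n)e^{in\cdot x}$, is positive (i.e. real-valued and non-negative), and the family $\{K_{\mathfrak{m}_\Lambda}\}_{\Lambda>0}$ is a good kernel.
   Context: $\mathbb{T}^d=\mathbb{R}^d/2\pi\mathbb{Z}^d$, equipped with normalized Haar measure $dx$ (total mass $1$). For $\Lambda\ge 0$ and $n\in\mathbb{Z}^d$ let $\overline{\mathrm{B}}_\Lambda(n)\subset\mathbb{R}^d$ be the closed Euclidean ball of radius $\Lambda$ centred at $n$, $\overline{\mathrm{B}}_\Lambda=\overline{\mathrm{B}}_\Lambda(0)$, and set $$\mathcal{N}_{\mathrm{B}}(\Lambda)=\#\big(\overline{\mathrm{B}}_\Lambda\cap\mathbb{Z}^d\big),\quad \mathcal{N}_{\mathrm{L}}(\Lambda,n)=\#\big(\overline{\mathrm{B}}_\Lambda\cap\overline{\mathrm{B}}_\Lambda(n)\cap\mathbb{Z}^d\big),\quad \mathfrak{m}_\Lambda(n)=\frac{\mathcal{N}_{\mathrm{L}}(\Lambda,n)}{\mathcal{N}_{\mathrm{B}}(\Lambda)}.$$ The function $\mathfrak{m}_\Lambda$ has finite support, so the sum defining $K_{\mathfrak{m}_\Lambda}$ (the inverse Fourier transform of $\mathfrak{m}_\Lambda$) is finite. A family $\{K_\Lambda\}_{\Lambda>0}$ in $\mathrm{L}^1(\mathbb{T}^d)$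 is called a good kernel if (1) $\int_{\mathbb{T}^d}K_\Lambda(x)\,dx=1$ for all $\Lambda$, and (2) for all $\delta>0$, $\int_{\mathbb{T}^d\setminus\mathrm{B}_\delta(0)}K_\Lambda(x)\,dx\to0$ as $\Lambda\to\infty$, where $\mathrm{B}_\delta(0)$ is the ball of radius $\delta$ around $0$ in $\mathbb{T}^d$. *)

(* Defs.v *)
From HB Require Import structures.
From mathcomp Require Import all_boot all_order all_algebra finmap.
From mathcomp Require Import all_classical all_reals all_analysis.
From mathcomp Require Import complex.

Set Implicit Arguments.
Unset Strict Implicit.
Unset Printing Implicit Defensive.

Import Order.TTheory GRing.Theory Num.Theory numFieldNormedType.Exports.

Local Open Scope classical_set_scope.
Local Open Scope ring_scope.
Local Open Scope quotient_scope.
Local Open Scope complex_scope.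

(** The canonical norm of 'rV[R]_d is the sup norm, hence the separate Euclidean
    norm below. *)

Section Euclidean.
Context {R : realType} {d : nat}.

Definition dotp (x y : 'rV[R]_d) : R := \sum_(j < d) x ord0 j * y ord0 j.

Definition enorm (x : 'rV[R]_d) : R := Num.sqrt (dotp x x).

Definition open_eball (c : 'rV[R]_d) (r : R) : set 'rV[R]_d :=
  [set x | enorm (x - c) < r].

Definition closed_eball (c : 'rV[R]_d) (r : R) : set 'rV[R]_d :=
  [set x | enorm (x - c) <= r].

Definition ZtoR (n : 'rV[int]_d) : 'rV[R]_d := map_mx intr n.

(* #(A `&` Z^d); [fset_set] is only meaningful on finite sets, and is only
   applied below to subsets of [closed_eball 0 L]: see [finite_lattice_ball]. *)
Definition lattice_card (A : set 'rV[R]_d) : nat :=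
  #|` fset_set [set k : 'rV[int]_d | A (ZtoR k)] |%fset.

Lemma finite_lattice_ball (L : R) :
  finite_set [set k : 'rV[int]_d | closed_eball 0 L (ZtoR k)].
Proof.
have [N LN] : exists N : nat, L < N%:R.
  by exists (Num.bound `|L|); rewrite (le_lt_trans (ler_norm _))// archi_boundP.
pose f (g : {ffun 'I_d -> 'I_(N + N).+1}) : 'rV[int]_d :=
  \row_j ((g j)%:Z - N%:Z).
apply: (@sub_finite_set _ _ (f @` setT)); last exact/finite_image/finite_finset.
move=> k; rewrite /closed_eball /= subr0 => kL.
have kN j : `|k ord0 j| <= N%:Z.
  rewrite -(ler_int R) -[X in _ <= X]/(N%:R).
  apply: le_trans (ltW LN); apply: le_trans kL.
  rewrite /enorm intr_norm -sqrtr_sqr ler_wsqrtr// /dotp (bigD1 j)//= mxE.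
  by rewrite expr2 lerDl sumr_ge0// => i _; rewrite -expr2 sqr_ge0.
exists [ffun j => inord (absz (k ord0 j + N%:Z))] => //.
apply/rowP => j; rewrite mxE ffunE.
have := kN j; rewrite ler_norml => /andP[k1 k2].
have k0 : 0 <= k ord0 j + N%:Z by rewrite -lerBlDr sub0r.
rewrite inordK; first by rewrite gez0_abs// addrK.
by rewrite ltnS -lez_nat gez0_abs// PoszD lerD2r.
Qed.

Definition NB (L : R) : nat := lattice_card (closed_eball 0 L).

Definition NL (L : R) (n : 'rV[int]_d) : nat :=
  lattice_card (closed_eball 0 L `&` closed_eball (ZtoR n) L).

Definition multm (L : R) (n : 'rV[int]_d) : R := (NL L n)%:R / (NB L)%:R.

End Euclidean.

Section Torus.
Context (R : realType) (d : nat).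

Definition torus_eq : rel 'rV[R]_d := fun x y =>
  `[< exists n : 'rV[int]_d, x - y = (2 * trigo.pi) *: ZtoR n >].

Lemma torus_eq_equiv : equiv_class_of torus_eq.
Proof.
split.
- move=> x; apply/asboolP; exists 0.
  by rewrite /ZtoR map_mx0 scaler0 subrr.
- move=> x y; apply/asboolP/asboolP => -[n xy]; exists (- n);
    by rewrite -opprB xy /ZtoR map_mxN scalerN.
- move=> y x z /asboolP[m xy] /asboolP[n yz]; apply/asboolP; exists (m + n).
  by rewrite -(subrKA y) xy yz /ZtoR map_mxD scalerDr.
Qed.

Canonical torus_equiv := EquivRelPack torus_eq_equiv.

Definition torus : Type := {eq_quot torus_equiv}.

HB.instance Definition _ := EqQuotient.on torus.
HB.instance Definition _ := Choice.on torus.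
HB.instance Definition _ := isPointed.Build torus (\pi_torus 0).

Lemma eq_torusP (x y : 'rV[R]_d) :
  \pi_torus x = \pi_torus y <->
  exists n : 'rV[int]_d, x - y = (2 * trigo.pi) *: ZtoR n.
Proof.
split.
- move=> xy; have : torus_eq x y by apply/eqmodP.
  by move/asboolP.
- by move=> H; apply/eqmodP; apply/asboolP.
Qed.

Definition torus_of_tuple (t : d.-tuple (measurableTypeR R)) : torus :=
  \pi_torus (\row_j tnth t j).

(* The quotient sigma-algebra: a set is measurable iff its preimage in R^d is
   (in d.-tuple R, which carries the product Borel sigma-algebra). This is the
   Borel sigma-algebra of the torus. *)
Definition torus_display : measure_display.
Proof. exact. Qed.

Let torus_measurable : set (set torus) :=
  image_set_system [set: d.-tuple (measurableTypeR R)] torus_of_tuple measurable.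

Let torus_sigma_algebra : sigma_algebra setT torus_measurable.
Proof. exact/sigma_algebra_image/sigma_algebra_measurable. Qed.

Let torus_measurable0 : torus_measurable set0.
Proof. by case: torus_sigma_algebra. Qed.

Let torus_measurableC A : torus_measurable A -> torus_measurable (~` A).
Proof. by case: torus_sigma_algebra => _ /(_ A); rewrite setTD. Qed.

Let torus_bigcup (F : (set torus)^nat) :
  (forall k, torus_measurable (F k)) -> torus_measurable (\bigcup_k (F k)).
Proof. by case: torus_sigma_algebra => _ _; exact. Qed.

HB.instance Definition _ := @isMeasurable.Build torus_display torus
  torus_measurable torus_measurable0 torus_measurableC torus_bigcup.

Lemma measurable_torus_of_tuple : measurable_fun setT torus_of_tuple.
Proof. by move=> _ A mA; exact: mA. Qed.

HB.instance Definition _ := isMeasurableFun.Build _ _ _ _ torus_of_tuple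
  measurable_torus_of_tuple.

End Torus.

(** Haar probability on the torus: image of the uniform probability on the
    fundamental domain [-pi, pi]^d, itself the d-fold product of the uniform
    probability on [-pi, pi]. *)

Section Haar.
Context (R : realType).

Lemma ltNpi_pi : - trigo.pi < trigo.pi :> R.
Proof. by rewrite gtrN// pi_gt0. Qed.

Definition cons_tuple_pair (n : nat) (p : measurableTypeR R * n.-tuple (measurableTypeR R)) :
    n.+1.-tuple (measurableTypeR R) :=
  [tuple of p.1 :: p.2].

Lemma measurable_cons_tuple_pair n : measurable_fun setT (@cons_tuple_pair n).
Proof. exact: measurable_cons. Qed.

HB.instance Definition _ n := isMeasurableFun.Build _ _ _ _
  (@cons_tuple_pair n) (@measurable_cons_tuple_pair n).

Fixpoint uniform_cube (n : nat) : probability (n.-tuple (measurableTypeR R)) R :=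
  match n with
  | 0 => \d_ [tuple]
  | n'.+1 => distribution (uniform_prob ltNpi_pi \x uniform_cube n')%E
               (@cons_tuple_pair n')
  end.

Definition haar (d : nat) : probability (torus R d) R :=
  distribution (uniform_cube d) (@torus_of_tuple R d).

End Haar.

Section Kernels.
Context {R : realType} {d : nat}.
Local Notation T := (torus R d).

(* Ball of radius r around 0 in the quotient metric. *)
Definition torus_ball0 (r : R) : set T := \pi_T @` open_eball 0 r.

Definition cexpi (t : R) : R[i] := cos t +i* sin t.

(* The value does not depend on the representative of x: see
   [inv_fourier_pi]. The sum is over the support of the summand, which is
   finite in all uses below. *)
Definition inv_fourier (m : 'rV[int]_d -> R[i]) (x : T) : R[i] :=
  \sum_(n \in [set: 'rV[int]_d]) m n * cexpi (dotp (ZtoR n) (repr x)).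

Lemma cexpi_periodic (t : R) (k : int) :
  cexpi (t + 2 * trigo.pi * k%:~R) = cexpi t.
Proof.
have H n (u : R) : cexpi (u + 2 * trigo.pi * n%:R) = cexpi u.
  rewrite /cexpi mulr_natr mulr_natl.
  by rewrite (periodicn (@cosD2pi R)) (periodicn (@sinD2pi R)).
case: k => n; first exact: H.
by rewrite -(H n.+1) NegzE mulrNz mulrN subrK.
Qed.

Lemma inv_fourier_pi (m : 'rV[int]_d -> R[i]) (x : 'rV[R]_d) :
  inv_fourier m (\pi_T x) =
  \sum_(n \in [set: 'rV[int]_d]) m n * cexpi (dotp (ZtoR n) x).
Proof.
apply: eq_fsbigr => n _; congr (_ * _).
have [k xk] : exists k : 'rV[int]_d,
    repr (\pi_T x) - x = (2 * trigo.pi) *: ZtoR k.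
  by apply/eq_torusP; rewrite reprK.
have -> : repr (\pi_T x) = x + (2 * trigo.pi) *: ZtoR k by rewrite -xk subrKC.
rewrite -[RHS](cexpi_periodic _ (\sum_j n ord0 j * k ord0 j)).
congr cexpi; rewrite /dotp rmorph_sum mulr_sumr -big_split/=.
by apply: eq_bigr => j _; rewrite !mxE mulrDr rmorphM mulrCA.
Qed.

Definition Kmult (L : R) : T -> R[i] :=
  inv_fourier (fun n => (multm L n)%:C).

Definition torus_integral (A : set T) (f : T -> R[i]) : R[i] :=
  (\int[haar R d]_(x in A) complex.Re (f x)) +i*
  (\int[haar R d]_(x in A) complex.Im (f x)).

Definition torus_L1 (f : T -> R[i]) : Prop :=
  (haar R d).-integrable setT (fun x => (complex.Re (f x))%:E) /\
  (haar R d).-integrable setT (fun x => (complex.Im (f x))%:E).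

(* Only the members K L with 0 < L matter. *)
Definition good_kernel (K : R -> T -> R[i]) : Prop :=
  [/\ forall L : R, 0 < L -> torus_L1 (K L),
      forall L : R, 0 < L -> torus_integral setT (K L) = 1
    & forall r : R, 0 < r ->
        (torus_integral (~` torus_ball0 r) (K L) : R[i]^o)
          @[L --> +oo] --> (0 : R[i]^o) ].

End Kernels.

(* Main.v *)
Require Import Defs.
From mathcomp Require Import all_boot all_order all_algebra finmap.
From mathcomp Require Import all_classical all_reals all_analysis.
From mathcomp Require Import complex.
From mathcomp Require Import measurable_realfun.
From mathcomp Require Import zify ring lra.

(** Write [B] for the set of lattice points of the closed ball of radius [L]
    and [D x = \sum_(k in B) e^(i k.x)]. Since [NL L n] counts the pairs
    [(k, l)] of points of [B] with [k - l = n] ([NL_sum]), the kernel is of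
    Fejer type: [Kmult L x = |D x|^2 / #B]. It is therefore nonnegative
    ([Kmult_ge0]), and its real part is the average of the cosines
    [cos ((k - l).x)] over pairs of [B] ([kernel_cubeE]).

    The Haar measure is the image of the uniform probability on the cube
    [[-pi, pi]^d], for which [cos (n.t)] has mean 1 if [n = 0] and mean 0
    otherwise ([has_mean_cos]). Only the pairs [k = l] contribute to the
    integral of the kernel, which equals 1.

    The concentration at 0 reduces to one integral: the periodic function
    [\sum_j (1 - cos t_j)] is nonnegative, and bounded below by a positive
    constant off the ball of radius [r] of the torus ([torus_ball0_far]), so
    that it suffices to show that its integral against the kernel tends to 0.
    By orthogonality this integral is the sum over [j] of the proportion of
    points [k] of [B] such that [k - e_j] is not in [B]
    ([kernel_cube_defect]). There is at most one such point on each lattice line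
    of direction [e_j], hence [O(L^(d-1))] of them, whereas [B] contains a cube
    with at least [(L/d)^d] points; the proportion is [O(1/L)]
    ([boundary_ratio]). *)

Set Implicit Arguments.
Unset Strict Implicit.
Unset Printing Implicit Defensive.

Import Order.TTheory GRing.Theory Num.Theory numFieldNormedType.Exports.

Local Open Scope fset_scope.
Local Open Scope ring_scope.

(** * Counting in finite sets *)

Lemma card_filter_fset (K : choiceType) (B : {fset K}) (P : pred K) :
  #|` [fset k in B | P k]| = (\sum_(k <- B) P k)%N.
Proof.
rewrite card_fset_sum1 big_fset/= big_mkcond/=.
by apply: eq_bigr => k _; case: (P k).
Qed.

Lemma sum_pred1_fset (K : choiceType) (V : nmodType) (B : {fset K}) (x : K)
    (F : K -> V) : \sum_(k <- B) F k *+ (x == k) = F x *+ (x \in B).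
Proof.
have [xB|xB] := boolP (x \in B).
  rewrite (big_fsetD1 x)//= eqxx big_seq big1 ?addr0// => k.
  by rewrite !inE => /andP[kx _]; rewrite eq_sym (negbTE kx).
rewrite big_seq big1// => k kB; case: eqP => // xk.
by rewrite -xk (negbTE xB) in kB.
Qed.

Lemma sum_pairs_fset (V : pzSemiRingType) (K : choiceType) (B : {fset K})
    (P : rel K) (a : K -> K) :
  (forall k l, P k l = (a k == l)) ->
  \sum_(k <- B) \sum_(l <- B) (P k l)%:R = (\sum_(k <- B) (a k \in B))%:R :> V.
Proof.
move=> Pa; rewrite natr_sum; apply: eq_bigr => k _.
by under eq_bigr do rewrite Pa; rewrite sum_pred1_fset.
Qed.

Lemma leq_card_fset_inj (K : choiceType) (T : finType) (B : {fset K})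
    (f : K -> T) : {in B &, injective f} -> (#|` B| <= #|T|)%N.
Proof.
move=> finj; rewrite -(size_map f) -(card_uniqP _) ?max_card//.
by rewrite map_inj_in_uniq// fset_uniq.
Qed.

Lemma geq_card_fset_inj (K : choiceType) (T : finType) (B : {fset K})
    (f : T -> K) : injective f -> (forall t, f t \in B) -> (#|T| <= #|` B|)%N.
Proof.
move=> finj fB; rewrite cardE -(size_map f); apply: uniq_leq_size.
  by rewrite map_inj_uniq// enum_uniq.
by move=> _ /mapP[t _ ->].
Qed.

(** * Lattice points of a ball *)

Section Ball.
Context {R : realType} {d : nat}.
Implicit Types (L : R) (k n : 'rV[int]_d).

Definition lball L : {fset 'rV[int]_d} :=
  fset_set [set k : 'rV[int]_d | closed_eball 0 L (ZtoR k)]%classic.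

Lemma ZtoRB (k l : 'rV[int]_d) : ZtoR (k - l) = ZtoR k - ZtoR l :> 'rV[R]_d.
Proof. exact: map_mxB. Qed.

Lemma in_lball L k : (k \in lball L) = (enorm (ZtoR k : 'rV[R]_d) <= L).
Proof.
rewrite /lball in_fset_set; last exact: finite_lattice_ball.
by apply/idP/idP => [/set_mem|kL]; [|apply/mem_set];
  rewrite /closed_eball/= subr0.
Qed.

Lemma in_lball_sqr L k : 0 <= L ->
  (k \in lball L) = ((\sum_j (k ord0 j) ^+ 2)%:~R <= L ^+ 2).
Proof.
move=> L0; rewrite in_lball /enorm -[L in _ <= L]ger0_norm// -sqrtr_sqr.
rewrite ler_psqrt ?nnegrE ?sqr_ge0//.
  congr (_ <= _); rewrite /dotp rmorph_sum.
  by apply: eq_bigr => j _; rewrite !mxE -rmorphM expr2.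
by apply: sumr_ge0 => j _; rewrite -expr2 sqr_ge0.
Qed.

Lemma NBE L : @NB R d L = #|` lball L|.
Proof. by []. Qed.

Lemma NLE L n : NL L n = #|` [fset k in lball L | k - n \in lball L] |.
Proof.
rewrite /NL /lattice_card; congr (#|` _|); apply/fsetP => k.
rewrite in_fset_set; last first.
  by apply: sub_finite_set (finite_lattice_ball L) => x [].
rewrite !inE /= !in_lball ZtoRB.
by apply/idP/andP => [/set_mem|kL]; [|apply/mem_set];
  rewrite /closed_eball/= subr0.
Qed.

Lemma lball0 L : 0 <= L -> 0 \in lball L.
Proof.
move=> L0; rewrite in_lball_sqr// big1 ?sqr_ge0// => j _.
by rewrite !mxE expr0n.
Qed.

Lemma card_lball_gt0 L : 0 <= L -> (0 < #|` lball L|)%N.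
Proof.
by move=> L0; rewrite cardfs_gt0; apply/fset0Pn; exists 0; exact: lball0.
Qed.

Lemma lball_coord L (N : nat) k j : L <= N%:R -> k \in lball L ->
  `|k ord0 j| <= N%:Z.
Proof.
move=> LN; rewrite in_lball => kL; rewrite -(ler_int R) -[X in _ <= X]/(N%:R).
apply: le_trans LN; apply: le_trans kL.
rewrite /enorm intr_norm -sqrtr_sqr ler_wsqrtr// /dotp (bigD1 j)//= mxE.
by rewrite expr2 lerDl sumr_ge0// => i _; rewrite -expr2 sqr_ge0.
Qed.

(** A point [k] of the lens around [0] and [n] is determined by the pair
    [(k, k - n)] of points of the ball. *)
Lemma NL_sum L n :
  NL L n = (\sum_(k <- lball L) \sum_(l <- lball L) (k - l == n)%R)%N.
Proof.
rewrite NLE card_filter_fset; apply: eq_bigr => k _.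
rewrite -[RHS](@eq_bigr _ _ _ _ _ _ (fun l => 1%N *+ (k - n == l))); last first.
  by move=> l _; rewrite subr_eq addrC -subr_eq; case: (_ == _).
by rewrite sum_pred1_fset; case: (_ \in _).
Qed.

(** The left-hand side is an inverse Fourier transform when [F] is a character;
    the right-hand side then factors as a square modulus. *)
Lemma multm_sum L (F : 'rV[int]_d -> R[i]) :
  \sum_(n \in [set: 'rV[int]_d]) ((multm L n)%:C)%C * F n =
  ((#|` lball L|%:R)^-1)%:C%C *
    \sum_(k <- lball L) \sum_(l <- lball L) F (k - l).
Proof.
pose E := [fset k - l | k in lball L, l in lball L].
have kE k l : k \in lball L -> l \in lball L -> k - l \in E.
  by move=> kL lL; apply/imfset2P; exists k => //; exists l.
rewrite (fsbigTE E); last first.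
  move=> n nE; rewrite /multm NL_sum big_seq big1 ?mul0r ?rmorph0 ?mul0r//.
  move=> k kL; rewrite big_seq big1// => l lL; case: eqP => // kln.
  by move: nE; rewrite -kln kE.
have summandE n : (multm L n)%:C%C * F n = ((#|` lball L|%:R)^-1)%:C%C *
    \sum_(k <- lball L) \sum_(l <- lball L) F n *+ (k - l == n).
  rewrite /multm NBE mulrC mulrC rmorphM mulrAC mulrC NL_sum rmorph_nat.
  rewrite natr_sum mulr_suml; congr (_ * _); apply: eq_bigr => k _.
  by rewrite natr_sum mulr_suml; apply: eq_bigr => l _; rewrite mulr_natl.
rewrite (eq_bigr _ (fun n _ => summandE n)) -mulr_sumr; congr (_ * _).
rewrite exchange_big/= big_seq [RHS]big_seq; apply: eq_bigr => k kL.
rewrite exchange_big/= big_seq [RHS]big_seq; apply: eq_bigr => l lL.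
by rewrite sum_pred1_fset kE.
Qed.

End Ball.

(** * Proportion of lattice points near the boundary of a ball *)

Section Boundary.
Context {R : realType} {d : nat}.
Implicit Types (L : R) (k n : 'rV[int]_d.+1) (j : 'I_d.+1).

Definition unit_row j : 'rV[int]_d.+1 := delta_mx ord0 j.

Definition lball_boundary L j : {fset 'rV[int]_d.+1} :=
  [fset k in lball L | k - unit_row j \notin lball L].

(** Each line of direction [unit_row j] meets the ball in a segment, of which
    only the first lattice point is in the boundary. *)
Lemma boundary_line L j k k' : 0 <= L ->
  k \in lball_boundary L j -> k' \in lball_boundary L j ->
  (forall i, i != j -> k ord0 i = k' ord0 i) -> k = k'.
Proof.
move=> L0 kA k'A kk'.
suff kj : k ord0 j = k' ord0 j.
  by apply/rowP => i; have [->|/kk'] := eqVneq i j.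
have sqE n : n \in lball_boundary L j ->
    (forall i, i != j -> n ord0 i = k ord0 i) ->
    (((n ord0 j) ^+ 2 + \sum_(i | i != j) (k ord0 i) ^+ 2)%:~R <= L ^+ 2) &&
    (L ^+ 2 < ((n ord0 j - 1) ^+ 2 + \sum_(i | i != j) (k ord0 i) ^+ 2)%:~R).
  rewrite !inE/= => /andP[nL nL'] nk.
  move: nL nL'; rewrite !in_lball_sqr// -ltNge (bigD1 j)//= => nL.
  rewrite (bigD1 j)//= !mxE !eqxx/= => nL'.
  rewrite (eq_bigr (fun i => (n ord0 i) ^+ 2)); last by move=> i /nk ->.
  rewrite nL/=; apply: lt_le_trans nL' _; rewrite ler_int lerD2l.
  rewrite le_eqVlt; apply/orP; left; apply/eqP; apply: eq_bigr => i ij.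
  by rewrite !mxE (negbTE ij) andbF subr0.
have /andP[] := sqE k kA (fun i _ => erefl).
have /andP[] := sqE k' k'A (fun i ij => esym (kk' i ij)).
set S := \sum_(i | _) _ => a1 a2 a3 a4.
(* The four comparisons say that [x ^+ 2] and [y ^+ 2] are both less than
   [(x - 1) ^+ 2] and [(y - 1) ^+ 2]: then [x, y <= 0], and [x < y] or [y < x]
   would contradict one of them. *)
have := le_lt_trans a1 a2; have := le_lt_trans a1 a4.
have := le_lt_trans a3 a2; have := le_lt_trans a3 a4.
rewrite !ltr_int !ltrD2r; clear; move: (k _ _) (k' _ _) => x y.
nia.
Qed.

(** By [boundary_line], a boundary point is determined by its coordinates other
    than [j], each of which lies between [-N] and [N]. *)
Lemma card_boundary L (N : nat) j : 0 <= L -> L <= N%:R ->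
  (#|` lball_boundary L j| <= (N + N).+1 ^ d)%N.
Proof.
move=> L0 LN.
pose f k : {ffun 'I_d -> 'I_(N + N).+1} :=
  [ffun i => inord (absz (k ord0 (lift j i) + N%:Z))].
rewrite -[X in (X ^ _)%N]card_ord -[X in (_ ^ X)%N]card_ord -card_ffun.
apply: (@leq_card_fset_inj _ _ _ f) => k k' kA k'A /ffunP fkk'.
apply: (boundary_line L0 kA k'A) => i ij.
have [i' ->] : exists i', i = lift j i'.
  by move: ij; rewrite eq_sym => /unlift_some[i' ->]; exists i'.
have := fkk' i'; rewrite !ffunE => /(congr1 val).
have := kA; have := k'A; rewrite !inE => /andP[k'L _] /andP[kL _].
have := lball_coord (lift j i') LN kL; have := lball_coord (lift j i') LN k'L.
by rewrite /= => a1 a2; rewrite !inordK; lia.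
Qed.

(** The ball of radius [L] contains the cube with side [[0, L / d.+1]]. *)
Lemma card_lball_ge L : 0 <= L ->
  (L / d.+1%:R) ^+ d.+1 <= #|` lball L : {fset 'rV[int]_d.+1}|%:R.
Proof.
move=> L0; set m := Num.truncn (L / d.+1%:R).
have Ld0 : 0 <= L / d.+1%:R by rewrite divr_ge0.
have /andP[mL Lm] := truncn_itv Ld0; rewrite -/m in mL Lm.
apply: (@le_trans _ _ (m.+1 ^ d.+1)%:R).
  by rewrite natrX lerXn2r ?nnegrE// ltW.
pose f (g : {ffun 'I_d.+1 -> 'I_m.+1}) : 'rV[int]_d.+1 := \row_j (g j)%:Z.
rewrite ler_nat -[X in (X ^ _)%N]card_ord -[X in (_ ^ X)%N]card_ord -card_ffun.
apply: (@geq_card_fset_inj _ _ _ f) => [g g' /rowP gg'|g].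
  by apply/ffunP => j; have := gg' j; rewrite !mxE => -[] /val_inj.
rewrite in_lball_sqr// (@le_trans _ _ (\sum_(j < d.+1) (m%:R ^+ 2)))//.
  rewrite rmorph_sum ler_sum// => j _; rewrite mxE rmorphXn/=.
  by rewrite lerXn2r ?nnegrE// ?ler0z// -[_%:~R]/(_%:R) ler_nat -ltnS.
rewrite sumr_const card_ord -[X in X <= _]mulr_natl.
apply: (@le_trans _ _ ((d.+1%:R * m%:R) ^+ 2)).
  by rewrite exprMn ler_wpM2r ?sqr_ge0// ler_eXnr// ler1n.
by rewrite lerXn2r ?nnegrE// ?mulr_ge0// mulrC -ler_pdivlMr.
Qed.

(** With [N] the least integer above [L >= 1], the [2 N + 1] values of a
    coordinate are at most [2 L + 3 <= 5 L]; this is where the factor 5 comes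
    from, and the factor [d.+1] is the loss in [card_lball_ge]. *)
Lemma boundary_ratio L j : 1 <= L ->
  #|` lball_boundary L j|%:R / #|` lball L : {fset 'rV[int]_d.+1}|%:R
  <= (5 * d.+1%:R) ^+ d.+1 / L.
Proof.
move=> L1; have L0 : 0 < L by exact: lt_le_trans L1.
have B0 : 0 < #|` lball L : {fset 'rV[int]_d.+1}|%:R :> R.
  by rewrite ltr0n card_lball_gt0// ltW.
rewrite ler_pdivrMr// mulrAC ler_pdivlMr//.
set N := (Num.truncn L).+1.
have /andP[NL LN] := truncn_itv (ltW L0).
have card_le : #|` lball_boundary L j|%:R <= (5 * L) ^+ d.
  apply: (@le_trans _ _ ((N + N).+1 ^ d)%:R).
    by rewrite ler_nat card_boundary// ltW.
  rewrite natrX lerXn2r ?nnegrE ?mulr_ge0 ?(ltW L0)//.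
  by rewrite /N -natr1 natrD -natr1; lra.
apply: (@le_trans _ _ ((5 * L) ^+ d * (5 * L))).
  by rewrite ler_pM// ?(ltW L0)//; lra.
have -> : 5 * L = (5 * d.+1%:R) * (L / d.+1%:R).
  by rewrite -mulrA [_ * (L / _)]mulrC divfK.
rewrite -exprSr exprMn ler_wpM2l ?exprn_ge0 ?mulr_ge0//.
exact/card_lball_ge/ltW.
Qed.

End Boundary.

(** * Trigonometric integrals over the cube *)

Section CubeIntegral.
Context {R : realType}.
Local Notation pi := trigo.pi.

Lemma cos_periodicz (t : R) (k : int) : cos (t + 2 * pi * k%:~R) = cos t.
Proof. by have [] := cexpi_periodic t k. Qed.

Lemma sin_periodicz (t : R) (k : int) : sin (t + 2 * pi * k%:~R) = sin t.
Proof. by have [] := cexpi_periodic t k. Qed.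

Lemma measurable_cos_phase d (T : measurableType d) (f : T -> R) (c : R) :
  measurable_fun setT f -> measurable_fun setT (fun t => cos (f t + c)).
Proof.
move=> mf; apply: (@measurableT_comp _ _ _ _ _ _ (@cos R) _ (fun t => f t + c)).
  exact: (continuous_measurable_fun (@continuous_cos R)).
exact: measurable_funD.
Qed.

(** Adding 1 makes the integrand nonnegative, so that integrals against the
    uniform probability, and iterated integrals in [integral_cos_cube], require
    no integrability condition. *)
Lemma integral_cos_period (n : int) (c : R) :
  (\int[uniform_prob (@ltNpi_pi R)]_x (1 + cos (n%:~R * x + c))%:E =
   (1 + cos c *+ (n == 0))%:E)%E.
Proof.
have mf : measurable_fun setT (fun x : R => (1 + cos (n%:~R * x + c))%:E).
  apply/measurable_EFinP; apply: measurable_funD => //.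
  by apply: measurable_cos_phase; exact: measurable_funM.
have f_ge0 x : (0 <= (1 + cos (n%:~R * x + c))%:E)%E.
  by rewrite lee_fin -lerBlDl sub0r cos_geN1.
rewrite integral_uniform//.
have pi2 : (pi - - pi : R) != 0.
  by rewrite opprK -mulr2n mulrn_eq0/= gt_eqF ?pi_gt0.
have [->|n0] := eqVneq n 0.
  under eq_integral do rewrite mul0r add0r.
  rewrite integral_cst//= lebesgue_measure_itv/= lte_fin ltNpi_pi.
  by rewrite -EFinD -EFinM mulrCA mulVf ?mulr1.
have n0R : n%:~R != 0 :> R by rewrite intr_eq0.
(* An antiderivative: its increment over a period is [2 pi], since [sin] takes
   the same value at both ends. *)
pose F (x : R) := x + (n%:~R)^-1 * sin (n%:~R * x + c).
have d_arg (x : R) : is_derive x 1 (fun x : R => n%:~R * x + c) n%:~R.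
  have := @is_deriveD _ _ _ (n%:~R \*: (@id R)) (cst c) x 1 _ _
    (is_deriveZ _ (is_derive_id x 1)) (is_derive_cst c x 1).
  by rewrite addr0 /GRing.scale/= mulr1.
have dF (x : R) : is_derive x 1 F (1 + cos (n%:~R * x + c)).
  have := @is_deriveD _ _ _ (@id R)
    ((n%:~R)^-1 \*: (sin \o (fun x : R => n%:~R * x + c))) x 1 _ _
    (is_derive_id x 1) (is_deriveZ _ (is_derive1_comp _ (d_arg x))).
  rewrite /GRing.scale/= => /(_ _ (is_derive_sin _)).
  by rewrite mulrCA mulVf// mulr1.
have contF : continuous F.
  by move=> x; exact/differentiable_continuous/derivable1_diffP.
have cf : continuous (fun x : R => 1 + cos (n%:~R * x + c)).
  move=> x; apply: cvgD; first exact: cvg_cst.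
  apply: continuous_comp; last exact: continuous_cos.
  exact/differentiable_continuous/derivable1_diffP.
rewrite (@continuous_FTC2 _ _ F)//.
- have sinE : sin (n%:~R * pi + c) = sin (n%:~R * - pi + c).
    by rewrite -[RHS](sin_periodicz _ n); congr sin; lra.
  have FE : F pi - F (- pi) = pi - - pi by rewrite /F sinE; ring.
  by rewrite -EFinB FE -EFinM mulVf ?mulr0n ?addr0.
- exact: ltNpi_pi.
- exact: continuous_subspaceT.
- split.
  + by move=> x _.
  + exact/cvg_at_right_filter/contF.
  + exact/cvg_at_left_filter/contF.
- by move=> x _; rewrite derive1E; apply: derive_val.
Qed.

Definition phase d (n : 'rV[int]_d) (t : d.-tuple R) : R :=
  \sum_j (n ord0 j)%:~R * tnth t j.

Lemma measurable_phase d (n : 'rV[int]_d) :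
  measurable_fun [set: d.-tuple (measurableTypeR R)] (@phase d n).
Proof.
apply: measurable_sum => j; apply: measurable_funM => //.
exact: measurable_tnth.
Qed.

Lemma phaseS d (n : 'rV[int]_d.+1) (x : R) (t : d.-tuple R) :
  phase n [tuple of x :: t] =
  (n ord0 ord0)%:~R * x + phase (\row_j n ord0 (lift ord0 j)) t.
Proof.
rewrite /phase big_ord_recl tnth0; congr (_ + _); apply: eq_bigr => j _.
by rewrite tnthS mxE.
Qed.

Lemma phaseD d (m n : 'rV[int]_d) (t : d.-tuple R) :
  phase (m + n) t = phase m t + phase n t.
Proof.
rewrite /phase -big_split; apply: eq_bigr => j _.
by rewrite mxE intrD mulrDl.
Qed.

(** The free phase [c] makes the induction on the dimension go through: once the
    last coordinates are integrated, the first one is part of the phase. *)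
Lemma integral_cos_cube d (n : 'rV[int]_d) (c : R) :
  (\int[uniform_cube R d]_t (1 + cos (phase n t + c))%:E =
   (1 + cos c *+ (n == 0))%:E)%E.
Proof.
have ge0 (u : R) : (0 <= (1 + cos u)%:E)%E.
  by rewrite lee_fin -lerBlDl sub0r cos_geN1.
have mf m (p : 'rV[int]_m) b :
    measurable_fun [set: m.-tuple (measurableTypeR R)]
      (fun t => (1 + cos (phase p t + b))%:E).
  apply/measurable_EFinP; apply: measurable_funD => //.
  by apply: measurable_cos_phase; exact: measurable_phase.
elim: d n c => [|d IH] n c /=.
  rewrite integral_dirac//; last exact: mf.
  rewrite diracT mul1e /phase big_ord0 add0r.
  by have -> : n == 0 by apply/eqP/rowP => -[].
rewrite ge0_integral_distribution//=; last exact: mf.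
rewrite fubini_tonelli1//=; last first.
  exact: (measurableT_comp (mf _ n c) (@measurable_cons_tuple_pair R d)).
rewrite /fubini_F/=.
pose n' : 'rV[int]_d := \row_j n ord0 (lift ord0 j).
have inner (x : R) :
    (\int[uniform_cube R d]_t
       (1 + cos (phase n (cons_tuple_pair (x, t)) + c))%:E =
     (1 + cos ((n ord0 ord0)%:~R * x + c) *+ (n' == 0))%:E)%E.
  rewrite -IH; apply: eq_integral => t _; congr (1 + cos _)%:E.
  by rewrite phaseS -/n' addrAC addrC.
under eq_integral do rewrite inner.
have -> : (n == 0) = (n ord0 ord0 == 0) && (n' == 0).
  apply/eqP/andP => [n0|[/eqP a /eqP b]].
    rewrite n0 mxE eqxx; split=> //; apply/eqP/rowP => j.
    by rewrite /n' n0 !mxE.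
  apply/rowP => j; rewrite [RHS]mxE; case: (unliftP ord0 j) => [i|] ->//.
  by move/rowP: b => /(_ i); rewrite !mxE.
case: (n' == 0); rewrite ?andbT ?andbF /=.
  exact: integral_cos_period.
under eq_integral do rewrite mulr0n addr0.
by rewrite integral_cst//= mul1e mulr0n addr0 probability_setT.
Qed.

End CubeIntegral.

Section Mean.
Context {R : realType} {d : nat}.
Local Notation cube := (uniform_cube R d).
Implicit Types (f g : d.-tuple (measurableTypeR R) -> R).

(** Integrability and value are carried together, so that the mean of a
    trigonometric polynomial follows its syntax. *)
Definition has_mean f (v : R) :=
  cube.-integrable setT (EFin \o f) /\ \int[cube]_t f t = v.

Lemma eq_has_mean f g v w : has_mean f v -> f =1 g -> v = w -> has_mean g w.
Proof. by move=> fv /funext <- <-. Qed.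

Lemma has_meanD f g v w :
  has_mean f v -> has_mean g w -> has_mean (fun t => f t + g t) (v + w).
Proof.
move=> [fi <-] [gi <-]; split; last by rewrite RintegralD.
exact: (integrableD measurableT fi gi).
Qed.

Lemma has_meanZ f v (c : R) :
  has_mean f v -> has_mean (fun t => c * f t) (c * v).
Proof.
move=> [fi <-]; split; last by rewrite RintegralZl.
exact: (integrableZl measurableT c fi).
Qed.

Lemma has_mean_cst (c : R) : has_mean (fun=> c) c.
Proof.
split; first exact: finite_measure_integrable_cst.
by rewrite Rintegral_cst//= probability_setT mulr1.
Qed.

Lemma has_mean_sum (I : Type) (s : seq I) (f : I -> d.-tuple R -> R)
    (v : I -> R) :
  (forall i, has_mean (f i) (v i)) ->
  has_mean (fun t => \sum_(i <- s) f i t) (\sum_(i <- s) v i).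
Proof.
move=> fv; elim: s => [|i s IH].
  rewrite big_nil (_ : (fun _ => _) = fun=> 0); first exact: has_mean_cst.
  by apply/funext => t; rewrite big_nil.
rewrite big_cons (_ : (fun _ => _) = fun t => f i t + \sum_(j <- s) f j t).
  exact: has_meanD.
by apply/funext => t; rewrite big_cons.
Qed.

Lemma has_mean_cos (n : 'rV[int]_d) :
  has_mean (fun t => cos (phase n t)) (n == 0)%:R.
Proof.
have mcos : measurable_fun setT (fun t : d.-tuple (measurableTypeR R) =>
    cos (phase n t)).
  rewrite (_ : (fun _ => _) = fun t => cos (phase n t + 0)).
    by apply: measurable_cos_phase; exact: measurable_phase.
  by apply/funext => t; rewrite addr0.
have icos : cube.-integrable setT (EFin \o (fun t => cos (phase n t))).
  apply: measurable_bounded_integrable => //.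
    by rewrite (le_lt_trans (probability_le1 cube measurableT))// ltry.
  exists 1; split; first exact: num_real.
  by move=> M M1 t _ /=; rewrite (le_trans (cos_max _))// ltW.
split=> //; have := integral_cos_cube n (0 : R).
under eq_integral do rewrite addr0.
move=> /(congr1 fine)/=; rewrite -/(Rintegral _ _ _) RintegralD//.
  by rewrite Rintegral_cst//= probability_setT mulr1 cos0 => /addrI.
exact: finite_measure_integrable_cst.
Qed.

End Mean.

(** * The kernel as a square modulus *)

Section Kernel.
Context {R : realType} {d : nat}.
Implicit Types (L : R) (t : d.-tuple (measurableTypeR R)).

Lemma cexpiB (a b : R) : cexpi (a - b) = cexpi a * conjc (cexpi b).
Proof. by rewrite /cexpi cosB sinB; simpc; congr (_ +i* _)%C; ring. Qed.

Lemma dotpBl (x y z : 'rV[R]_d) : dotp (x - y) z = dotp x z - dotp y z.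
Proof.
by rewrite /dotp -sumrB; apply: eq_bigr => j _; rewrite !mxE mulrBl.
Qed.

Lemma Kmult_pi L (x : 'rV[R]_d) : Kmult L (\pi_(torus R d)%qT x) =
  ((#|` lball L : {fset 'rV[int]_d}|%:R)^-1)%:C%C *
  \sum_(k <- lball L) \sum_(l <- lball L) cexpi (dotp (ZtoR (k - l)) x).
Proof.
rewrite /Kmult inv_fourier_pi.
exact: (multm_sum L (fun n => cexpi (dotp (ZtoR n) x))).
Qed.

(** The double sum over [k] and [l] is the product of [\sum_k e^(i k.y)] with
    its conjugate. *)
Lemma Kmult_ge0 L (x : torus R d) : 0 <= Kmult L x.
Proof.
rewrite -[x]reprK Kmult_pi; apply: mulr_ge0; first by rewrite ler0c invr_ge0.
set y := repr x.
have -> : \sum_(k <- lball L) \sum_(l <- lball L) cexpi (dotp (ZtoR (k - l)) y)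
  = (\sum_(k <- lball L) cexpi (dotp (ZtoR k) y)) *
    conjc (\sum_(k <- lball L) cexpi (dotp (ZtoR k) y)).
  rewrite mulr_suml; apply: eq_bigr => k _; rewrite rmorph_sum mulr_sumr.
  by apply: eq_bigr => l _; rewrite ZtoRB dotpBl cexpiB.
exact: mulcJ_ge0.
Qed.

Definition kernel_cube L t : R := complex.Re (Kmult L (torus_of_tuple t)).

Lemma kernel_cube_ge0 L t : 0 <= kernel_cube L t.
Proof. by have := Kmult_ge0 L (torus_of_tuple t); rewrite lecE => /andP[]. Qed.

Lemma kernel_cubeE L t : kernel_cube L t =
  (#|` lball L : {fset 'rV[int]_d}|%:R)^-1 *
  \sum_(k <- lball L) \sum_(l <- lball L) cos (phase (k - l) t).
Proof.
rewrite /kernel_cube Kmult_pi.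
have ReZ (c : R) (z : R[i]) : complex.Re (c%:C%C * z) = c * complex.Re z.
  by case: z => a b /=; rewrite mul0r subr0.
rewrite ReZ; congr (_ * _); rewrite raddf_sum; apply: eq_bigr => k _.
rewrite raddf_sum; apply: eq_bigr => l _ /=; congr cos.
by apply: eq_bigr => j _; rewrite !mxE.
Qed.

Lemma kernel_cube_mean L : 0 <= L -> has_mean (kernel_cube L) 1.
Proof.
move=> L0; have B0 : #|` lball L : {fset 'rV[int]_d}|%:R != 0 :> R.
  by rewrite pnatr_eq0 -lt0n card_lball_gt0.
apply: (eq_has_mean (has_meanZ (#|` lball L : {fset 'rV[int]_d}|%:R)^-1
  (has_mean_sum (lball L) (fun k => has_mean_sum (lball L)
     (fun l => has_mean_cos (R := R) (k - l)))))).
  by move=> t; rewrite kernel_cubeE.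
rewrite (sum_pairs_fset R _ (a := id)); last by move=> k l; rewrite subr_eq0.
rewrite -card_filter_fset (_ : [fset k in lball L | _] = lball L) ?mulVf//.
by apply/fsetP => k; rewrite !inE andbb.
Qed.

End Kernel.

(** * Defect of the kernel in a coordinate direction *)

Section Defect.
Context {R : realType} {d : nat}.
Implicit Types (L : R) (j : 'I_d.+1).

Lemma phase_unit_row j (t : d.+1.-tuple R) : phase (unit_row j) t = tnth t j.
Proof.
rewrite /phase (bigD1 j)//= mxE !eqxx mul1r big1 ?addr0// => i ij.
by rewrite mxE (negbTE ij) andbF mul0r.
Qed.

Lemma phaseB_unit_row (n : 'rV[int]_d.+1) j (t : d.+1.-tuple R) :
  phase (n - unit_row j) t = phase n t - tnth t j.
Proof.
by rewrite -[in RHS](subrK (unit_row j) n) [in RHS]phaseD phase_unit_row addrK.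
Qed.

(** Expanding [(1 - cos t_j) cos (n.t)] with [n = k - l] gives
    [cos (n.t) - (cos ((n - e_j).t) + cos ((n + e_j).t)) / 2]. The first term
    counts the points of the ball; each of the other two counts the points [k]
    such that [k - e_j] is in the ball. *)
Lemma kernel_cube_defect L j : 0 <= L ->
  has_mean (fun t => (1 - cos (tnth t j)) * kernel_cube L t)
    (#|` lball_boundary L j|%:R / #|` lball L : {fset 'rV[int]_d.+1}|%:R).
Proof.
move=> L0; pose e := unit_row j.
have hcos (k l : 'rV[int]_d.+1) := has_meanD (has_meanD
  (has_mean_cos (R := R) (k - l))
  (has_meanZ (- 2^-1) (has_mean_cos (R := R) (k - l - e))))
  (has_meanZ (- 2^-1) (has_mean_cos (R := R) (k - l + e))).
apply: (eq_has_mean (has_meanZ (#|` lball L : {fset 'rV[int]_d.+1}|%:R)^-1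
  (has_mean_sum (lball L) (fun k => has_mean_sum (lball L) (hcos k))))).
  move=> t; rewrite kernel_cubeE [RHS]mulrCA; congr (_ * _); rewrite mulr_sumr.
  apply: eq_bigr => k _; rewrite mulr_sumr; apply: eq_bigr => l _.
  move: (k - l) => n; rewrite phaseB_unit_row phaseD phase_unit_row cosB cosD.
  by field.
rewrite mulrC; congr (_ / _).
under eq_bigr do rewrite !big_split/= -!mulr_sumr.
rewrite !big_split/= -!mulr_sumr [X in _ + _ * X]exchange_big/=.
rewrite (sum_pairs_fset R _ (a := id)); last by move=> k l; rewrite subr_eq0.
rewrite (sum_pairs_fset R _ (a := fun k => k - e)); last first.
  by move=> k l; rewrite addrAC subr_eq0.
rewrite (sum_pairs_fset R _ (a := fun k => k - e)); last first.
  by move=> k l; rewrite -[RHS]subr_eq0 -[LHS]oppr_eq0 opprD opprB addrAC.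
rewrite -!card_filter_fset (_ : [fset k in lball L | _] = lball L); last first.
  by apply/fsetP => k; rewrite !inE andbb.
rewrite -[in LHS](cardfsID [fset k in lball L | k - e \in lball L] (lball L)).
rewrite (_ : _ `&` _ = [fset k in lball L | k - e \in lball L]); last first.
  by apply/fsetP => k; rewrite !inE andbA andbb.
rewrite (_ : _ `\` _ = lball_boundary L j); last first.
  apply/fsetP => k; rewrite !inE.
  by case: (k \in lball L); rewrite ?andbT ?andbF.
by rewrite natrD; field.
Qed.

End Defect.

(** * Balls and integrals on the torus *)

Section TorusGeometry.
Context {R : realType} {d : nat}.
Local Notation pi := trigo.pi.

Lemma cos_near_zero_period (x : R) : exists2 m : int,
  `|x - 2 * pi * m%:~R| <= pi & cos x = cos (x - 2 * pi * m%:~R).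
Proof.
have pi0 : 0 < 2 * pi :> R by rewrite mulr_gt0// pi_gt0.
exists (Num.floor ((x + pi) / (2 * pi))); last first.
  by rewrite -[RHS](cos_periodicz _ (Num.floor ((x + pi) / (2 * pi)))) subrK.
have /andP[] := floor_itv ((x + pi) / (2 * pi)).
rewrite ler_pdivlMr// ltr_pdivrMr// intrD => a1 a2.
by rewrite ler_norml; apply/andP; split; lra.
Qed.

(** Translate the coordinates of [t] into [[-pi, pi]]. One of them has absolute
    value at least [r / d.+1], as otherwise the translated point would be in the
    Euclidean ball of radius [r]; and [cos] decreases on [[0, pi]]. *)
Lemma torus_ball0_far (r : R) : 0 < r -> exists2 c : R, 0 < c &
  forall t : d.-tuple (measurableTypeR R),
    (~` torus_ball0 r)%classic (torus_of_tuple t) ->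
    c <= \sum_(j < d) (1 - cos (tnth t j)).
Proof.
move=> r0; pose rho := r / d.+1%:R; pose delta := Num.min rho pi.
have rho0 : 0 < rho by rewrite divr_gt0.
have delta_itv : delta \in `[0, pi].
  by rewrite in_itv/= le_min (ltW rho0) pi_ge0/= ge_min lexx orbT.
have delta0 : 0 < delta by rewrite lt_min rho0 pi_gt0.
exists (1 - cos delta).
  by rewrite subr_gt0 -[X in _ < X]cos0 ltr_cos// in_itv/= lexx pi_ge0.
move=> t far.
have [m mpi mcos] : exists2 m : 'I_d -> int,
    forall j, `|tnth t j - 2 * pi * (m j)%:~R| <= pi &
    forall j, cos (tnth t j) = cos (tnth t j - 2 * pi * (m j)%:~R).
  have /choice[m mP] : forall j, exists m : int,
      `|tnth t j - 2 * pi * m%:~R| <= pi /\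
      cos (tnth t j) = cos (tnth t j - 2 * pi * m%:~R).
    by move=> j; have [m] := cos_near_zero_period (tnth t j); exists m.
  by exists m => j; have [] := mP j.
pose y : 'rV[R]_d := \row_j (tnth t j - 2 * pi * (m j)%:~R).
have [j yj] : exists j, delta <= `|y ord0 j|.
  apply: contrapT => /forallNP small; apply: far; exists y; last first.
    apply/eq_torusP; exists (\row_j (- m j)); apply/rowP => j.
    by rewrite !mxE intrN addrAC subrr add0r mulrN.
  rewrite /open_eball/= subr0 /enorm -[r]ger0_norm ?(ltW r0)// -sqrtr_sqr.
  rewrite ltr_sqrt ?exprn_gt0//.
  apply: (@le_lt_trans _ _ (\sum_(j < d) rho ^+ 2)).
    apply: ler_sum => j _; rewrite -expr2 -real_normK ?num_real//.
    rewrite lerXn2r ?nnegrE// ?(ltW rho0)//.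
    have /negP := small j; rewrite -ltNge => /ltW/le_trans; apply.
    by rewrite ge_min lexx.
  rewrite sumr_const card_ord -[X in X < _]mulr_natl.
  have -> : r = d.+1%:R * rho by rewrite mulrC divfK.
  rewrite [X in _ < X]exprMn ltr_pM2r ?exprn_gt0// (@lt_le_trans _ _ d.+1%:R)//.
    by rewrite ltr_nat.
  by rewrite ler_eXnr// ler1n.
rewrite (bigD1 j)//= -[X in X <= _]addr0 lerD//.
  rewrite lerD2l lerN2 mcos -[X in X <= _]cos_norm.
  have := mpi j; move: yj; rewrite mxE => dy ypi.
  by rewrite leNgt ltr_cos ?in_itv/= ?normr_ge0// -leNgt.
by apply: sumr_ge0 => i _; rewrite subr_ge0 cos_le1.
Qed.

Lemma measurable_torus (A : set (torus R d)) :
  measurable (@torus_of_tuple R d @^-1` A)%classic -> measurable A.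
Proof. by move=> mA; rewrite /measurable/= /image_set_system/= setTI. Qed.

(** The preimage of the ball is the union of the balls centred at the countably
    many points of the lattice [2 pi Z^d]. *)
Lemma measurable_torus_ball0 (r : R) : measurable (@torus_ball0 R d r).
Proof.
apply: measurable_torus.
pose dist (n : 'rV[int]_d) (t : d.-tuple (measurableTypeR R)) : R :=
  enorm ((\row_j tnth t j) - (2 * pi) *: ZtoR n).
rewrite (_ : (_ @^-1` _)%classic =
    (\bigcup_n (dist n @^-1` `]-oo, r[))%classic); last first.
  apply/seteqP; split=> t /=.
    move=> [y]; rewrite /open_eball/= subr0 => yr /eq_torusP[n yt].
    exists (- n) => //=; rewrite in_itv/= /dist.
    rewrite (_ : _ - _ = y)// /ZtoR map_mxN scalerN opprK -/(ZtoR n) -yt.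
    by rewrite addrC subrK.
  move=> [n _] /=; rewrite in_itv/= => tr.
  exists ((\row_j tnth t j) - (2 * pi) *: ZtoR n).
    by rewrite /open_eball/= subr0.
  apply/eq_torusP; exists (- n).
  by rewrite /ZtoR map_mxN scalerN addrAC subrr add0r.
apply: countable_bigcupT_measurable => [|n]; first exact: countableP.
rewrite -[X in measurable X]setTI.
suff mdist : measurable_fun setT (dist n) by apply: mdist => //.
apply: (@measurableT_comp _ _ _ _ _ _ (@Num.sqrt R)).
  exact: (continuous_measurable_fun (@sqrt_continuous R)).
rewrite /dotp; apply: measurable_sum => j.
under eq_fun do rewrite !mxE.
by apply: measurable_funM; apply: measurable_funB => //; exact: measurable_tnth.
Qed.

Lemma measurable_fun_torus (f : torus R d -> R) :
  measurable_fun setT (f \o @torus_of_tuple R d) -> measurable_fun setT f.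
Proof.
move=> mf _ B mB; apply: measurable_torus; rewrite setTI.
by rewrite -[X in measurable X]setTI; exact: mf.
Qed.

Lemma integrable_torus_measurable (f : torus R d -> R) :
  (uniform_cube R d).-integrable setT (EFin \o (f \o @torus_of_tuple R d)) ->
  measurable_fun setT (EFin \o f).
Proof.
move=> /integrableP[/measurable_EFinP mf _].
by apply/measurable_EFinP; exact: measurable_fun_torus mf.
Qed.

Lemma integrable_haar (f : torus R d -> R) :
  (uniform_cube R d).-integrable setT (EFin \o (f \o @torus_of_tuple R d)) ->
  (haar R d).-integrable setT (EFin \o f).
Proof.
move=> fi.
apply: (integrable_pushforward (measurable_torus_of_tuple (d := d))) => //.
exact: integrable_torus_measurable.
Qed.

Lemma Rintegral_haar (f : torus R d -> R) (A : set (torus R d)) :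
  measurable A ->
  (uniform_cube R d).-integrable setT (EFin \o (f \o @torus_of_tuple R d)) ->
  \int[haar R d]_(x in A) f x =
  \int[uniform_cube R d]_(t in (@torus_of_tuple R d @^-1` A)%classic)
    f (torus_of_tuple t).
Proof.
move=> mA fi; rewrite /Rintegral; congr fine.
apply: (integral_pushforward (measurable_torus_of_tuple (d := d))) => //.
  exact: integrable_torus_measurable.
apply: integrableS fi => //.
by rewrite -[X in measurable X]setTI; exact: measurable_torus_of_tuple.
Qed.

Lemma Im_Kmult (L : R) :
  (fun x : torus R d => complex.Im (Kmult L x)) = fun=> 0.
Proof. by apply/funext => x; exact/ger0_Im/Kmult_ge0. Qed.

Lemma torus_integral_Kmult (L : R) (A : set (torus R d)) :
  0 <= L -> measurable A ->
  torus_integral A (Kmult L) =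
  (\int[uniform_cube R d]_(t in (@torus_of_tuple R d @^-1` A)%classic)
     kernel_cube L t)%:C%C.
Proof.
move=> L0 mA; rewrite /torus_integral Im_Kmult Rintegral_cst//= mul0r.
rewrite Rintegral_haar//.
exact: (kernel_cube_mean L0).1.
Qed.

End TorusGeometry.

(** * The good kernel property *)

Section GoodKernel.
Context {R : realType} {d : nat}.
Implicit Types (L : R).
Local Notation cube := (uniform_cube R d.+1).

(** Off the ball, the kernel is at most [c^-1] times its product with
    [\sum_j (1 - cos t_j)]; as this product is nonnegative, its integral may be
    extended to the whole cube, where [kernel_cube_defect] computes it. *)
Lemma kernel_cube_concentrates (r : R) : 0 < r -> exists2 C : R, 0 < C &
  forall L, 1 <= L ->
  \int[cube]_(t in (@torus_of_tuple R d.+1 @^-1` (~` torus_ball0 r))%classic)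
    kernel_cube L t <= C / L.
Proof.
move=> r0; have [c c0 far] := torus_ball0_far (d := d.+1) r0.
exists (c^-1 * (d.+1%:R * (5 * d.+1%:R) ^+ d.+1)).
  by rewrite mulr_gt0 ?invr_gt0// mulr_gt0// exprn_gt0// mulr_gt0.
move=> L L1; have L0 : 0 <= L := le_trans ler01 L1.
have mE : measurable (@torus_of_tuple R d.+1 @^-1` (~` torus_ball0 r))%classic.
  rewrite -[X in measurable X]setTI; apply: measurable_torus_of_tuple => //.
  by apply: measurableC; apply: measurable_torus_ball0.
have [intG valG] := has_meanZ c^-1 (has_mean_sum (index_enum 'I_d.+1)
  (fun j => kernel_cube_defect (R := R) j L0)).
have [intK _] := kernel_cube_mean (d := d.+1) L0.
apply: (@le_trans _ _ (\int[cube]_t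
   (c^-1 * \sum_(j < d.+1) (1 - cos (tnth t j)) * kernel_cube L t))).
  rewrite Rintegral_mkcond; apply: le_Rintegral => //.
    rewrite -restrict_EFin; apply/(integrable_mkcond _ mE).1.
    exact: (integrableS measurableT mE _ intK).
  move=> t _; rewrite patchE -mulr_suml.
  have sum0 : 0 <= \sum_(j < d.+1) (1 - cos (tnth t j)).
    by apply: sumr_ge0 => j _; rewrite subr_ge0 cos_le1.
  case: ifPn => [/set_mem tE|_]; last first.
    by rewrite !mulr_ge0 ?invr_ge0 ?(ltW c0)// kernel_cube_ge0.
  rewrite mulrA ler_peMl ?kernel_cube_ge0// mulrC ler_pdivlMr// mul1r.
  exact: far.
rewrite valG -[X in _ <= X]mulrA ler_wpM2l ?invr_ge0 ?(ltW c0)//.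
apply: (@le_trans _ _ (\sum_(j < d.+1) (5 * d.+1%:R) ^+ d.+1 / L)).
  by apply: ler_sum => j _; exact: boundary_ratio.
by rewrite sumr_const card_ord -[X in X <= _]mulr_natl mulrA.
Qed.

End GoodKernel.

(* In R[i], 0 <= z means that z is real and nonnegative. *)
Theorem proposition3p8 (R : realType) (d : nat) (hd : (1 <= d)%N) :
  (forall L : R, 0 < L -> forall x : torus R d, 0 <= Kmult L x) /\
  good_kernel (fun L : R => Kmult L : torus R d -> R[i]).
Proof.
split; first by move=> L _ x; exact: Kmult_ge0.
case: d hd => // d _; split.
- move=> L L0; split.
    apply: (@integrable_haar _ _ (fun x => complex.Re (Kmult L x))).
    exact: (kernel_cube_mean (d := d.+1) (ltW L0)).1.
  rewrite [X in _.-integrable _ (fun x => (X x)%:E)]Im_Kmult.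
  exact: finite_measure_integrable_cst.
- move=> L L0; rewrite torus_integral_Kmult ?(ltW L0)//.
  by rewrite (kernel_cube_mean (d := d.+1) (ltW L0)).2.
- move=> r r0; have [C C0 bound] := kernel_cube_concentrates (d := d) r0.
  apply/cvgr0Pnorm_lt => eps eps0.
  have -> : eps = (complex.Re eps)%:C%C.
    by move: eps0; rewrite ltcE => /andP[/eqP + _]; case: eps => a b /= ->.
  have e0 : 0 < complex.Re eps by move: eps0; rewrite ltcE => /andP[].
  near=> L.
  have L1 : 1 <= L by near: L; exact: nbhs_pinfty_ge.
  have L0 : 0 < L := lt_le_trans ltr01 L1.
  rewrite torus_integral_Kmult ?(ltW L0)//; last first.
    by apply: measurableC; apply: measurable_torus_ball0.
  rewrite ger0_norm; last first.
    by rewrite ler0c; apply: Rintegral_ge0 => t _; exact: kernel_cube_ge0.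
  rewrite ltcR; apply: le_lt_trans (bound L L1) _.
  rewrite ltr_pdivrMr// mulrC -ltr_pdivrMr//.
  by near: L; apply: nbhs_pinfty_gt; exact: num_real.
Unshelve. all: by end_near.
Qed.
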